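(* Let $(\Omega,\Sigma,\mu)$ be a separable measure space, that is, the $\sigma$-algebra $\Sigma$ is generated by a countable collection of subsets of $\Omega$. Let $1\leq p\leq\infty$ and let $L_p(\Omega,\Sigma,\mu)$ be the corresponding (real) $L_p$-space. If $\dim L_p(\Omega,\Sigma,\mu)\geq 2$, then $C(L_p(\Omega,\Sigma,\mu))=2^{1/p}$ if $1\leq p\leq 2$, and $C(L_p(\Omega,\Sigma,\mu))=2^{1-1/p}$ if $2\leq p\leq\infty$.
   Context: For a metric space $(X,d)$ and $\lambda \geq 0$, say that $(X,d)$ satisfies the $(\lambda,0)$-four-point inequality if for all $x,y,z,w\in X$, $d(x,y)+d(z,w)\le \lambda\max\{d(x,z)+d(y,w),\ d(x,w)+d(y,z)\}$. The quadrilateral constant of $(X,d)$ is $C_0(X,d)=\inf\{\lambda\geq 0 \mid (X,d)\text{ satisfies the }(\lambda,0)\text{-four-point inequality}\}$. For a real Banach space $B$ with norm $\|\cdot\|$, $C(B)$ denotes $C_0(B,d)$ where $d(u,v)=\|u-v\|$. By convention $1/\infty=0$. *)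

(* Defs.v *)
(* The Lebesgue spaces over an arbitrary measure are taken from
   MathComp-Analysis: an element of [LspaceType mu p1] is a class of
   measurable real-valued functions modulo almost-everywhere equality, whose
   Lp-norm is finite.  The library provides this type but not its
   vector-space structure and norm, which are added here. *)
From HB Require Import structures.
From mathcomp Require Import all_boot all_order all_algebra.
From mathcomp Require Import all_classical all_reals all_analysis.
From mathcomp Require Import measurable_realfun ess_sup_inf.

Set Implicit Arguments.
Unset Strict Implicit.
Unset Printing Implicit Defensive.

Import Order.TTheory GRing.Theory Num.Theory.
Import numFieldNormedType.Exports.

Local Open Scope classical_set_scope.
Local Open Scope ring_scope.

Section four_point.
Context {R : realType}.

Definition four_point {X : Type} (d : X -> X -> R) (lambda : R) : Prop :=
  forall x y z w : X,
    d x y + d z w <= lambda * Num.max (d x z + d y w) (d x w + d y z).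

(* By the triangle inequality a metric satisfies [four_point d 2], so this is
   the infimum of a nonempty set that is bounded from below. *)
Definition quad_const_metric {X : Type} (d : X -> X -> R) : R :=
  inf [set lambda : R | 0 <= lambda /\ four_point d lambda].

(* Only the norm of B is used, so B need not be assumed complete. *)
Definition quad_const (B : normedModType R) : R :=
  quad_const_metric (fun u v : B => `|u - v|).

End four_point.

Definition countably_generated {d : measure_display} (T : measurableType d) :=
  exists G : set (set T), countable G /\ d.-measurable = <<s G >>.

(* The dimension of V, possibly infinite, is at least n. *)
Definition dim_ge {R : realType} (V : lmodType R) (n : nat) : Prop :=
  exists v : 'I_n -> V, forall c : 'I_n -> R,
    \sum_(i < n) c i *: v i = 0 -> forall i, c i = 0.

Section Lspace_structure.
Context {d : measure_display} {T : measurableType d} {R : realType}.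
Variable mu : {measure set T -> \bar R}.

Lemma ae_eq_Lnorm (p : \bar R) (f g : T -> R) : (1 <= p)%E ->
  measurable_fun setT f -> measurable_fun setT g -> f = g %[ae mu] ->
  'N[mu]_p[EFin \o f]%E = 'N[mu]_p[EFin \o g]%E.
Proof.
move=> p1 mf mg fg; rewrite unlock /Lnorm.
case: p p1 => [r r1|_|//].
- have mN (h : T -> R) : measurable_fun setT h ->
      measurable_fun setT (fun x => `|(EFin \o h) x| `^ r)%E.
    move=> mh; apply: (@measurableT_comp _ _ _ _ _ _ (fun x => x `^ r)%E) => //=.
      exact: (measurableT_comp (measurable_poweR _)).
    by do 2?apply: measurableT_comp => //.
  congr (_ `^ _)%E; apply: ge0_ae_eq_integral => //=; do ?exact: mN.
  by apply: filterS fg => x /(_ I) /= + _ => ->.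
- case: ifPn => // _; apply: eq_ess_sup.
  by apply: filterS fg => x /(_ I) /= ->.
Qed.

Context {p : \bar R} (p1 : (1 <= p)%E).
Local Notation Lp := (LspaceType mu p1).
Local Notation Lf := (LfunType mu p1).
Local Open Scope quotient_scope.

(* [R] and [measurableTypeR R] carry the same measurable sets, but under
   different displays, hence the two conversions below. *)
Lemma measurable_toR (f : {mfun T >-> R}) :
  measurable_fun setT (f : T -> measurableTypeR R).
Proof. exact: (@measurable_funPT _ _ _ _ f). Qed.

Lemma measurable_ofR (f : {mfun T >-> measurableTypeR R}) :
  measurable_fun setT (f : T -> R).
Proof. exact: (@measurable_funPT _ _ _ _ f). Qed.

Definition mfun_toR (f : {mfun T >-> R}) : {mfun T >-> measurableTypeR R} :=
  HB.pack_for {mfun T >-> measurableTypeR R} (f : T -> measurableTypeR R)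
    (isMeasurableFun.Build d _ T (measurableTypeR R) f (measurable_toR f)).

Definition Lclass_mfun (f : Lf) : {mfun_ mu, T >-> measurableTypeR R} :=
  \pi_({mfun_ mu, T >-> measurableTypeR R}) (mfun_toR f).

Lemma repr_Lclass_mfun (f : Lf) :
  (Lclass_mfun f : T -> R) = f %[ae mu].
Proof.
suff : repr (Lclass_mfun f) = mfun_toR f %[mod {mfun_ mu, T >-> measurableTypeR R}].
  by move/eqP; rewrite eqmodE => /asboolP.
by rewrite reprK.
Qed.

Lemma Lclass_finite (f : Lf) : finite_norm mu p (Lclass_mfun f : T -> R).
Proof.
rewrite /finite_norm (ae_eq_Lnorm p1 _ _ (repr_Lclass_mfun f)) //.
- exact: Lfunction_finite.
- exact: measurable_ofR.
Qed.

Definition Lclass (f : Lf) : Lp :=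
  HB.pack_for Lp (Lclass_mfun f)
    (isFinLebesgue.Build d T R mu p p1 (Lclass_mfun f) (Lclass_finite f)).

Lemma Lrepr_subproof (F : Lp) :
  (repr (LebesgueSpace.sort F) : T -> R) \in Lfun mu p.
Proof.
rewrite inE; apply/andP; split; rewrite inE /=.
- exact: measurable_ofR.
- exact: (@Lebesgue_finite _ _ _ _ _ _ F).
Qed.

Definition Lrepr (F : Lp) : Lf := Lfun_Sub p1 (Lrepr_subproof F).

Lemma LclassK (f : Lf) : (Lrepr (Lclass f) : T -> R) = f %[ae mu].
Proof. exact: repr_Lclass_mfun. Qed.

Lemma Lspace_inj (F G : Lp) :
  LebesgueSpace.sort F = LebesgueSpace.sort G -> F = G.
Proof.
case: F => F [[cF]]; case: G => G [[cG]] /= FG.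
by case: G / FG cG => cG; rewrite (Prop_irrelevance cF cG).
Qed.

Lemma Lclass_eqP (f g : Lf) :
  Lclass f = Lclass g <-> (f : T -> R) = g %[ae mu].
Proof.
split=> [fg|fg].
  apply: ae_eq_trans (LclassK g); rewrite -fg.
  exact/ae_eq_sym/LclassK.
apply: Lspace_inj; apply/eqP; rewrite /= /Lclass_mfun eqmodE.
exact/asboolP.
Qed.

Lemma LreprK (F : Lp) : Lclass (Lrepr F) = F.
Proof.
apply: Lspace_inj => /=; rewrite /Lclass_mfun -[RHS]reprK.
by apply/eqP; rewrite eqmodE; apply/asboolP; exact: ae_eq_refl.
Qed.

Lemma Lspace_eqP (F G : Lp) :
  F = G <-> (Lrepr F : T -> R) = Lrepr G %[ae mu].
Proof. by rewrite -Lclass_eqP !LreprK. Qed.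

Definition Lzero : Lp := Lclass 0.
Definition Lopp (F : Lp) : Lp := Lclass (- Lrepr F).
Definition Ladd (F G : Lp) : Lp := Lclass (Lrepr F + Lrepr G).
Definition Lscale (a : R) (F : Lp) : Lp := Lclass (a *: Lrepr F).
Definition Lnrm (F : Lp) : R := fine 'N[mu]_p[EFin \o Lrepr F]%E.

Lemma LclassD (f g : Lf) : Ladd (Lclass f) (Lclass g) = Lclass (f + g).
Proof.
apply/Lclass_eqP; have := LclassK g; apply: (filterS2 _ _ (LclassK f)).
by move=> x fx gx _; exact: (f_equal2 +%R (fx I) (gx I)).
Qed.

Lemma LclassN (f : Lf) : Lopp (Lclass f) = Lclass (- f).
Proof.
apply/Lclass_eqP; apply: filterS (LclassK f).
by move=> x fx _; exact: (f_equal -%R (fx I)).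
Qed.

Lemma LclassZ (a : R) (f : Lf) : Lscale a (Lclass f) = Lclass (a *: f).
Proof.
apply/Lclass_eqP; apply: filterS (LclassK f).
by move=> x fx _; exact: (f_equal ( *%R a) (fx I)).
Qed.

Lemma Lclass_norm (f : Lf) : Lnrm (Lclass f) = fine 'N[mu]_p[EFin \o f]%E.
Proof. by congr fine; apply: ae_eq_Lnorm => //; exact: LclassK. Qed.

HB.instance Definition _ := gen_eqMixin Lp.
HB.instance Definition _ := gen_choiceMixin Lp.

Lemma LaddA : associative Ladd.
Proof.
move=> F G H; rewrite -(LreprK F) -(LreprK G) -(LreprK H).
by rewrite !LclassD addrA.
Qed.

Lemma LaddC : commutative Ladd.
Proof. by move=> F G; rewrite /Ladd addrC. Qed.

Lemma Ladd0 : left_id Lzero Ladd.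
Proof. by move=> F; rewrite -(LreprK F) LclassD add0r. Qed.

Lemma LaddN : left_inverse Lzero Lopp Ladd.
Proof. by move=> F; rewrite -(LreprK F) LclassN LclassD addNr. Qed.

HB.instance Definition _ := GRing.isZmodule.Build Lp LaddA LaddC Ladd0 LaddN.

Lemma LscaleA (a b : R) (F : Lp) : Lscale a (Lscale b F) = Lscale (a * b) F.
Proof. by rewrite -(LreprK F) !LclassZ scalerA. Qed.

Lemma Lscale1 : left_id 1 Lscale.
Proof. by move=> F; rewrite -(LreprK F) LclassZ scale1r. Qed.

Lemma LscaleDr : right_distributive Lscale +%R.
Proof.
move=> a F G; rewrite -(LreprK F) -(LreprK G) /GRing.add /=.
by rewrite !(LclassD, LclassZ) scalerDr.
Qed.

Lemma LscaleDl (F : Lp) : {morph Lscale^~ F : a b / a + b}.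
Proof.
move=> a b; rewrite -(LreprK F) [RHS]/GRing.add /=.
by rewrite !(LclassD, LclassZ) scalerDl.
Qed.

HB.instance Definition _ :=
  GRing.Zmodule_isLmodule.Build R Lp LscaleA Lscale1 LscaleDr LscaleDl.

Lemma ler_LnrmD (F G : Lp) : Lnrm (F + G) <= Lnrm F + Lnrm G.
Proof.
rewrite /GRing.add /= Lclass_norm; exact: ler_LnormD.
Qed.

Lemma LnrmZ (a : R) (F : Lp) : Lnrm (a *: F) = `|a| * Lnrm F.
Proof.
rewrite /GRing.scale /= Lclass_norm; apply: EFin_inj.
by rewrite EFinM !finite_norm_fine LnormZ.
Qed.

Lemma Lnrm_eq0 (F : Lp) : Lnrm F = 0 -> F = 0.
Proof.
move=> /fine_Lnormr_eq0 F0; rewrite -(LreprK F); exact/Lclass_eqP.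
Qed.

HB.instance Definition _ :=
  Lmodule_isNormed.Build R Lp ler_LnrmD LnrmZ Lnrm_eq0.

Lemma Lspace_normE (F : Lp) : `|F| = fine 'N[mu]_p[EFin \o Lrepr F]%E.
Proof. by []. Qed.

End Lspace_structure.

(* Main.v *)
Require Import Defs.
From mathcomp Require Import all_boot all_order all_algebra.
From mathcomp Require Import all_classical all_reals all_analysis.
From mathcomp Require Import measurable_realfun ess_sup_inf.
From mathcomp Require Import ring lra.

(** In a normed space put [a = x - y] and [b = w - z].  Then
    [a + b = (x - z) - (y - w)] and [a - b = (x - w) - (y - z)], so the two
    sums of opposite sides of a quadrilateral bound [`|a + b|] and [`|a - b|],
    while the diagonals are the halves of the norms of
    [(a + b) + (a - b)] and [(a + b) - (a - b)].  Hence the four-point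
    inequality with constant [L] follows from
    [`|u + v| + `|u - v| <= 2 L M] for all [u], [v] of norm at most [M]
    ([four_point_of_parallelogram]).

    In L_r with [r] finite, a scalar inequality
    [`|a + b|^r + `|a - b|^r <= k (`|a|^r + `|b|^r)] integrates to the same
    inequality between norms, and convexity of the r-th power turns that into
    the estimate above with [L = k^(1/r)] ([Lspace_parallelogram]).  Clarkson's
    easy inequalities provide [k = 2] for [r <= 2] and [k = 2^(r - 1)] for
    [r >= 2]; these give 2^(1/r) and 2^(1 - 1/r).  For the exponent infinity
    the constant 2 comes from the triangle inequality.

    For sharpness, two functions [u], [v] of norm 1 with disjoint supports span
    a copy of the plane with the r-norm: [`|u + v| = `|u - v| = 2^(1/r)].  The
    quadrilateral with diagonals from 0 to [u + v] and from [u] to [v] forces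
    [2^(1/r) <= L], and the one with diagonals from [u] to [- u] and from [v]
    to [- v] forces [2 <= L 2^(1/r)].  Such a pair exists as soon as the
    dimension is at least 2 ([disjoint_pair]): if no measurable set
    splits the functions of the space into two nonzero pieces, the quotient of
    any two of them is constant almost everywhere ([ae_proportional]). *)

Set Implicit Arguments.
Unset Strict Implicit.
Unset Printing Implicit Defensive.

Import Order.TTheory GRing.Theory Num.Theory.
Import numFieldNormedType.Exports.

Local Open Scope classical_set_scope.
Local Open Scope ring_scope.

(** * Powers of sums of nonnegative reals *)

Section powR_inequalities.
Context {R : realType}.
Implicit Types a b s t p x y : R.

(** Each summand [z] is the fraction [z / (x + y)] of the total, and raising
    a number of the unit interval to a power at least 1 decreases it. *)
Lemma powR_superadd s x y : 1 <= s -> 0 <= x -> 0 <= y ->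
  x `^ s + y `^ s <= (x + y) `^ s.
Proof.
move=> s1 x0 y0; have s0 : s != 0 by rewrite gt_eqF// (lt_le_trans ltr01).
have [->|xN0] := eqVneq x 0; first by rewrite powR0// !add0r.
have [->|yN0] := eqVneq y 0; first by rewrite powR0// !addr0.
have {xN0}xp : 0 < x by rewrite lt0r xN0.
have {yN0}yp : 0 < y by rewrite lt0r yN0.
have Sp : 0 < x + y by rewrite addr_gt0.
have share z : 0 < z -> z <= x + y -> z `^ s <= z / (x + y) * (x + y) `^ s.
  move=> z0 zS; rewrite -[in leLHS](divfK (lt0r_neq0 Sp) z).
  by apply: ge1r_powRZ; rewrite ?(ltW Sp)// divr_gt0//= ler_pdivrMr ?mul1r.
apply: le_trans (lerD (share x xp _) (share y yp _)) _; rewrite ?lerDl ?lerDr//.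
by rewrite -mulrDl -mulrDl divff ?lt0r_neq0// mul1r.
Qed.

Lemma powR_midconvex s x y : 1 <= s -> 0 <= x -> 0 <= y ->
  (x + y) `^ s <= 2 `^ (s - 1) * (x `^ s + y `^ s).
Proof.
move=> s1 x0 y0.
have -> : x + y = 2 * (2^-1 * x + 2^-1 * y) by lra.
rewrite powRM ?addr_ge0 ?mulr_ge0 ?invr_ge0// powRB ?pnatr_eq0 ?implybT//.
rewrite powRr1// -mulrA ler_wpM2l ?powR_ge0// mulrDr.
have half : 2^-1 = 1 - 2^-1 :> R by lra.
rewrite {2 4}half.
by apply: (convex_powR s1 (Itv01 _ _)) => //=;
  rewrite ?inE/= ?in_itv/= ?x0 ?y0 ?invr_ge0// invf_le1 ?ler1n.
Qed.

Lemma powRK s x : s != 0 -> 0 <= x -> (x `^ s) `^ s^-1 = x.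
Proof. by move=> s0 x0; rewrite -powRrM mulfV// powRr1. Qed.

Lemma powRVK s x : s != 0 -> 0 <= x -> (x `^ s^-1) `^ s = x.
Proof. by move=> s0 x0; rewrite -powRrM mulVf// powRr1. Qed.

(** Superadditivity of the inverse function, the power [s^-1 >= 1], applied to
    [x `^ s] and [y `^ s]. *)
Lemma powR_subadd s x y : 0 < s <= 1 -> 0 <= x -> 0 <= y ->
  (x + y) `^ s <= x `^ s + y `^ s.
Proof.
move=> /andP[s0 s1] x0 y0; have sN0 := lt0r_neq0 s0.
have V1 : 1 <= s^-1 by rewrite invf_ge1.
rewrite -[leRHS](powRVK sN0)// ?addr_ge0 ?powR_ge0//.
rewrite ge0_ler_powR ?(ltW s0)// ?nnegrE ?addr_ge0 ?powR_ge0//.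
rewrite -[x in leLHS](powRK sN0)// -[y in leLHS](powRK sN0)//.
by rewrite powR_superadd// powR_ge0.
Qed.

(** Convexity of the inverse function, as for subadditivity. *)
Lemma powR_midconcave s x y : 0 < s <= 1 -> 0 <= x -> 0 <= y ->
  x `^ s + y `^ s <= 2 `^ (1 - s) * (x + y) `^ s.
Proof.
move=> /andP[s0 s1] x0 y0; have sN0 := lt0r_neq0 s0.
have V1 : 1 <= s^-1 by rewrite invf_ge1.
have -> : 2 `^ (1 - s) = (2 `^ (s^-1 - 1)) `^ s :> R.
  by rewrite -powRrM mulrBl mulVf// mul1r.
rewrite -powRM ?powR_ge0 ?addr_ge0//.
rewrite -[leLHS](powRVK sN0)// ?addr_ge0 ?powR_ge0//.
rewrite ge0_ler_powR ?(ltW s0)// ?nnegrE ?mulr_ge0 ?addr_ge0 ?powR_ge0//.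
rewrite -[x in leRHS](powRK sN0)// -[y in leRHS](powRK sN0)//.
by rewrite powR_midconvex// powR_ge0.
Qed.

Lemma normr_powR_sqr p a : `|a| `^ p = (a ^+ 2) `^ (p / 2).
Proof.
by rewrite -real_normK ?num_real// -powR_mulrn// -powRrM mulrC divfK.
Qed.

(** Both Clarkson inequalities combine the parallelogram identity for the
    squares with a comparison between sums of (p/2)-th powers and the
    (p/2)-th power of a sum: concavity and subadditivity when [p / 2 <= 1],
    superadditivity and convexity when [p / 2 >= 1]. *)
Lemma clarkson_le2 p a b : 0 < p <= 2 ->
  `|a + b| `^ p + `|a - b| `^ p <= 2 * (`|a| `^ p + `|b| `^ p).
Proof.
move=> /andP[p0 p2]; have ps : 0 < p / 2 <= 1 by apply/andP; split; lra.
rewrite !(normr_powR_sqr p).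
apply: le_trans (powR_midconcave ps (sqr_ge0 _) (sqr_ge0 _)) _.
have -> : (a + b) ^+ 2 + (a - b) ^+ 2 = 2 * (a ^+ 2 + b ^+ 2) by ring.
rewrite powRM ?addr_ge0 ?sqr_ge0// mulrA -powRD ?pnatr_eq0 ?implybT//.
rewrite subrK powRr1// ler_wpM2l//.
by apply: powR_subadd; rewrite ?sqr_ge0.
Qed.

Lemma clarkson_ge2 p a b : 2 <= p ->
  `|a + b| `^ p + `|a - b| `^ p <= 2 `^ (p - 1) * (`|a| `^ p + `|b| `^ p).
Proof.
move=> p2; have ps : 1 <= p / 2 by lra.
rewrite !(normr_powR_sqr p).
apply: le_trans (powR_superadd ps (sqr_ge0 _) (sqr_ge0 _)) _.
have -> : (a + b) ^+ 2 + (a - b) ^+ 2 = 2 * (a ^+ 2 + b ^+ 2) by ring.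
rewrite powRM ?addr_ge0 ?sqr_ge0//.
have -> : p - 1 = p / 2 + (p / 2 - 1) by lra.
rewrite [in leRHS]powRD ?pnatr_eq0 ?implybT// -mulrA ler_wpM2l ?powR_ge0//.
by apply: powR_midconvex; rewrite ?sqr_ge0.
Qed.

End powR_inequalities.

(** * The four-point inequality in a normed space *)

Section quad_const.
Context {R : realType} {B : normedModType R}.
Implicit Types (L M : R) (u v : B).

Lemma quad_const_eq L : 0 <= L ->
  four_point (fun u v : B => `|u - v|) L ->
  (forall M, 0 <= M -> four_point (fun u v : B => `|u - v|) M -> L <= M) ->
  quad_const B = L.
Proof.
move=> L0 fpL minL; apply/eqP; rewrite eq_le; apply/andP; split.
  by apply: ge_inf => //; exists 0 => M [].
by apply: lb_le_inf; [exists L | move=> M [M0 /(minL M M0)]].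
Qed.

(** Twice each diagonal of a quadrilateral is the sum or the difference of
    the same two vectors, whose norms the sides control. *)
Lemma four_point_of_parallelogram L :
  (forall M u v, `|u| <= M -> `|v| <= M ->
     `|u + v| + `|u - v| <= 2 * (L * M)) ->
  four_point (fun u v : B => `|u - v|) L.
Proof.
move=> parL x y z w; set M := Num.max _ _.
(* Either vector is a difference of two opposite sides. *)
have uE : (x - y) + (w - z) = (x - z) - (y - w).
  by rewrite opprB addrACA [RHS]addrACA [- z - y]addrC.
have vE : (x - y) - (w - z) = (x - w) - (y - z).
  by rewrite !opprB addrACA [RHS]addrACA [- w - y]addrC.
have uM : `|(x - y) + (w - z)| <= M.
  by rewrite uE (le_trans (ler_normB _ _))// le_max lexx.
have vM : `|(x - y) - (w - z)| <= M.
  by rewrite vE (le_trans (ler_normB _ _))// le_max lexx orbT.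
have := parL M _ _ uM vM; rewrite (distrC z w).
move: (x - y) (w - z) => a b.
rewrite addrACA subrr addr0 opprD addrACA subrr add0r opprK -!mulr2n !normrMn.
by rewrite -mulrnDl -[leLHS]mulr_natl ler_pM2l.
Qed.

(** The quadrilateral with diagonals from 0 to [u + v] and from [u] to [v]
    has four sides of length 1. *)
Lemma four_point_ge_of_square L M u v : `|u| = 1 -> `|v| = 1 ->
  `|u + v| = L -> `|u - v| = L ->
  four_point (fun u v : B => `|u - v|) M -> L <= M.
Proof.
move=> u1 v1 uvp uvm /(_ 0 (u + v) u v).
rewrite !sub0r !normrN addrK [u + v - u]addrAC subrr add0r.
rewrite uvp uvm u1 v1 maxxx.
by move=> ?; lra.
Qed.

(** The quadrilateral with diagonals from [u] to [- u] and from [v] to [- v]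
    has diagonals of length 2 and sides of length at most [L]. *)
Lemma four_point_ge_of_diamond L M u v : `|u| = 1 -> `|v| = 1 ->
  `|u + v| <= L -> `|u - v| <= L ->
  0 <= M -> four_point (fun u v : B => `|u - v|) M -> 2 <= M * L.
Proof.
move=> u1 v1 uvp uvm M0 /(_ u (- u) v (- v)).
rewrite !opprK (addrC (- u)) -[- u - v]opprD normrN (distrC v).
rewrite -!mulr2n !normrMn u1 v1 => h.
have : M * Num.max (`|u - v| *+ 2) (`|u + v| *+ 2) <= M * (L *+ 2).
  by rewrite ler_wpM2l// ge_max !ler_pMn2r// uvp uvm.
by move=> /(le_trans h); rewrite mulrnAr; lra.
Qed.

End quad_const.

(** * Functions whose support cannot be split *)

Section proportional.
Context {d : measure_display} {T : measurableType d} {R : realType}.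
Variable mu : {measure set T -> \bar R}.

(** A 0-1 law: for every [t] the quotient [g / f] is almost everywhere at
    most [t] on the support of [f], or almost everywhere greater than [t]
    there.  The constant is the supremum of the [t] of the second kind. *)
Lemma ae_proportional (f g : T -> R) :
  measurable_fun setT f -> measurable_fun setT g ->
  (forall A, measurable A -> (\forall x \ae mu, A x -> f x = 0) \/
                             (\forall x \ae mu, ~ A x -> f x = 0)) ->
  ~ (\forall x \ae mu, f x = 0) ->
  (\forall x \ae mu, f x = 0 -> g x = 0) ->
  exists c, \forall x \ae mu, g x = c * f x.
Proof.
move=> mf mg dich fN0 fg0.
(* On the support of [f] this says [g / f <= t]; clearing the denominator
   makes measurability immediate. *)
pose A t := [set x | g x * f x <= t * f x ^+ 2].
have mA t : measurable (A t).
  have := @measurable_fun_ler _ _ _ setT _ _ (measurable_funM mg mf)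
    (measurable_funM (measurable_cst t) (measurable_funX 2 mf)).
  move=> /(_ measurableT [set true] I); rewrite setTI.
  by congr measurable; apply/seteqP; split=> x.
have AP t x : f x != 0 -> A t x <-> g x / f x <= t.
  move=> fx; rewrite /A /= -[g x in X in X <-> _](divfK fx).
  rewrite -[leLHS]mulrA -expr2.
  by rewrite ler_pM2r// exprn_even_gt0.
pose E := [set t | \forall x \ae mu, A t x -> f x = 0].
have notE t : ~ E t -> \forall x \ae mu, ~ A t x -> f x = 0.
  by move=> Et; case: (dich _ (mA t)).
(* The sets [A n] cover the support of [f], so [f] cannot vanish on all of
   them; likewise for the complements of the sets [A (- n)] below. *)
have E_bounded : exists n : nat, ~ E n%:R.
  apply: contrapT => /forallNP h; apply: fN0.
  have {h}/ae_foralln : forall n : nat, \forall x \ae mu, A n%:R x -> f x = 0.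
    by move=> n; have /contrapT := h n.
  apply: filterS => x h; apply: contrapT => /eqP fx.
  case: (ltrP 0 (g x / f x)) => [r0|r0].
    move/eqP: (fx); apply; apply: (h (Num.truncn (g x / f x)).+1).
    by apply/AP => //; rewrite ltW// truncnS_gt.
  by move/eqP: (fx); apply; apply: (h 0); apply/AP.
have E_nonempty : exists n : nat, E (- n%:R).
  apply: contrapT => /forallNP h; apply: fN0.
  have /ae_foralln := fun n => notE _ (h n).
  apply: filterS => x {}h; apply: contrapT => /eqP fx.
  move/eqP: (fx); apply; apply: (h (Num.truncn `|g x / f x|).+1) => /AP.
  move=> /(_ fx); apply/negP; rewrite -ltNge ltrNl.
  by rewrite (le_lt_trans _ (truncnS_gt _))// -normrN ler_norm.
have E_down s t : s <= t -> E t -> E s.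
  move=> st; apply: filterS => x h; have [//|fx] := eqVneq (f x) 0.
  by move=> /(AP _ _ fx) rs; apply: h; apply/AP => //; exact: le_trans st.
have ubE : has_ubound E.
  have [n En] := E_bounded; exists n%:R => t Et; rewrite leNgt.
  by apply/negP => /ltW nt; apply: En; exact: E_down Et.
have supE : has_sup E by split=> //; have [n En] := E_nonempty; exists (- n%:R).
exists (sup E).
have below : \forall x \ae mu, forall n : nat,
    A (sup E - n.+1%:R^-1) x -> f x = 0.
  apply: ae_foralln => n.
  have n0 : 0 < n.+1%:R^-1 :> R by rewrite invr_gt0.
  have [t Et] := sup_adherent n0 supE.
  by move=> /ltW /E_down; apply.
have above : \forall x \ae mu, forall n : nat,
    ~ A (sup E + n.+1%:R^-1) x -> f x = 0.
  apply: ae_foralln => n; apply: notE => /(ub_le_sup ubE).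
  by rewrite gerDl leNgt invr_gt0 ltr0n.
apply: filterS3 below above fg0 => x Bx Ax fgx.
have [fx0|fx] := eqVneq (f x) 0; first by rewrite fx0 mulr0 fgx.
have := fx; apply: contra_neqP => /eqP gNf.
rewrite -[g x](divfK fx) (inj_eq (mulIf fx)) in gNf.
have [rs|sr] : g x / f x < sup E \/ sup E < g x / f x.
- by apply/orP; rewrite -neq_lt.
- have [k] := ltr_add_invr rs; rewrite -ltrBrDr => /ltW rk.
  by apply: (Bx k); apply/AP.
- have [k sk] := ltr_add_invr sr.
  by apply: (Ax k) => /(AP _ _ fx); rewrite leNgt sk.
Qed.

End proportional.

(** * Lebesgue spaces of arbitrary exponent *)

Section Lspace.
Context {d : measure_display} {T : measurableType d} {R : realType}.
Variable mu : {measure set T -> \bar R}.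

Section any_exponent.
Context {p : \bar R} (p1 : (1 <= p)%E).
Local Notation Lf := (LfunType mu p1).
Local Notation Lp := (LspaceType mu p1).

Lemma measurable_Lfun (f : Lf) : measurable_fun setT (f : T -> R).
Proof. exact: (@measurable_funPT _ _ _ _ f). Qed.

Lemma LclassDE (f g : Lf) : Lclass f + Lclass g = Lclass (f + g) :> Lp.
Proof. exact: LclassD. Qed.

Lemma LclassNE (f : Lf) : - Lclass f = Lclass (- f) :> Lp.
Proof. exact: LclassN. Qed.

Lemma LclassZE c (f : Lf) : c *: Lclass f = Lclass (c *: f) :> Lp.
Proof. exact: LclassZ. Qed.

Lemma Lclass_eq0 (f : Lf) :
  Lclass f = 0 :> Lp <-> \forall x \ae mu, f x = 0.
Proof.
rewrite -[0]/(Lclass 0) Lclass_eqP; split; apply: filterS => x //.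
by move=> /(_ I).
Qed.

Lemma le_Lnorm (f g : T -> R) :
  measurable_fun setT f -> measurable_fun setT g ->
  (forall x, `|f x| <= `|g x|) ->
  ('N[mu]_p[EFin \o f] <= 'N[mu]_p[EFin \o g])%E.
Proof.
move=> mf mg fg; rewrite unlock /Lnorm; case: p p1 => [r r1|_|//].
- have r0 : 0 <= r by rewrite (le_trans ler01).
  have mN (h : T -> R) : measurable_fun setT h ->
      measurable_fun setT (fun x => (`|(EFin \o h) x| `^ r)%E).
    move=> mh; apply/measurable_EFinP.
    apply: (@measurableT_comp _ _ _ _ _ _ (@powR R ^~ r)) => //.
    exact: measurableT_comp.
  apply: gt0_ler_poweR; rewrite ?invr_ge0//.
  + by rewrite in_itv/= leey integral_ge0.
  + by rewrite in_itv/= leey integral_ge0.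
  apply: ge0_le_integral => //.
  + by move=> x _; exact: poweR_ge0.
  + exact: mN.
  + exact: mN.
  by move=> x _; rewrite lee_fin ge0_ler_powR ?nnegrE.
- case: ifPn => // mu0; apply: le_ess_sup; apply: nearW => x /=.
  by rewrite lee_fin.
Qed.

Lemma Lfun_restrict (f : Lf) (A : set T) : measurable A ->
  (f \_ A : T -> R) \in Lfun mu p.
Proof.
move=> mA.
have mfA : measurable_fun setT (f \_ A : T -> R).
  by apply/(measurable_restrictT f mA)/measurable_funTS/measurable_Lfun.
rewrite inE; apply/andP; split; rewrite inE //= /finite_norm.
apply: (@le_lt_trans _ _ 'N[mu]_p[EFin \o f]%E); last exact: Lfunction_finite.
apply: le_Lnorm => //.
by move=> x; rewrite patchE; case: ifPn => // _; rewrite normr0.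
Qed.

(** If no pair of restrictions of [F] and [G] to complementary sets is made
    of two nonzero functions, [ae_proportional] makes [G] a multiple of
    [F]. *)
Lemma disjoint_pair : dim_ge Lp 2 -> exists f g : Lf,
  [/\ forall x, f x = 0 \/ g x = 0, Lclass f != 0 :> Lp & Lclass g != 0 :> Lp].
Proof.
move=> [v vfree]; set F := v ord0; set G := v ord_max.
have FG a b : a *: F + b *: G = 0 -> a = 0 /\ b = 0.
  move=> ab; have := vfree (fun i => if i == ord0 then a else b).
  by rewrite !big_ord_recl big_ord0 addr0 /= => /(_ _) h; split;
    [apply: (h _ ord0)|apply: (h _ ord_max)];
    rewrite -?ab; congr (_ + _ *: v _); apply/val_inj.
apply: contrapT => nopair.
pose f := Lrepr F; pose g := Lrepr G.
have split (h k : Lf) A : measurable A ->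
    (\forall x \ae mu, A x -> h x = 0) \/ (\forall x \ae mu, ~ A x -> k x = 0).
  move=> mA; apply: contrapT => /not_orP[hA kA]; apply: nopair.
  exists (Lfun_Sub p1 (Lfun_restrict h mA)).
  exists (Lfun_Sub p1 (Lfun_restrict k (measurableC mA))).
  split.
  - move=> x /=; rewrite !patchE in_setC.
    by case: (x \in A); [right|left].
  - apply/eqP => /Lclass_eq0 h0; apply: hA; apply: filterS h0 => x /=.
    by rewrite patchE => + Ax; rewrite mem_set.
  - apply/eqP => /Lclass_eq0 k0; apply: kA; apply: filterS k0 => x /=.
    by rewrite patchE => + Ax; rewrite mem_set.
have fN0 : ~ \forall x \ae mu, f x = 0.
  move=> /Lclass_eq0; rewrite LreprK => F0.
  have [|/eqP + _] := FG 1 0; first by rewrite F0 scaler0 scale0r addr0.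
  by rewrite oner_eq0.
(* Split along the zero set of [f]: off it [f] is nonzero, so on it [g]
   must vanish. *)
have fg0 : \forall x \ae mu, f x = 0 -> g x = 0.
  have mS : measurable [set x | f x = 0].
    have -> : [set x | f x = 0] = setT `&` f @^-1` [set 0] by rewrite setTI.
    exact: measurable_Lfun.
  have [//|fN] := split g f _ mS; exfalso; apply: fN0.
  by apply: filterS fN => x h; apply: contrapT => fx; exact/fx/h.
have [c gf] := ae_proportional (measurable_Lfun f) (measurable_Lfun g)
  (split f f) fN0 fg0.
have [|_ /eqP] := FG c (- 1); last by rewrite oppr_eq0 oner_eq0.
rewrite scaleN1r -[F]LreprK -[G]LreprK LclassZE LclassNE LclassDE.
apply/Lclass_eq0; apply: filterS gf => x gx.
by rewrite -[LHS]/(c * f x - g x) gx subrr.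
Qed.

Lemma disjoint_unit_pair : dim_ge Lp 2 -> exists f g : Lf,
  [/\ forall x, f x = 0 \/ g x = 0, `|Lclass f : Lp| = 1 & `|Lclass g : Lp| = 1].
Proof.
move=> /disjoint_pair[f [g [fg f0 g0]]].
exists (`|Lclass f : Lp|^-1 *: f), (`|Lclass g : Lp|^-1 *: g); split.
- move=> x; case: (fg x) => h; [left|right].
    by rewrite -[LHS]/(_ * f x) h mulr0.
  by rewrite -[LHS]/(_ * g x) h mulr0.
- by rewrite -LclassZE normrZV ?unitfE ?normr_eq0.
- by rewrite -LclassZE normrZV ?unitfE ?normr_eq0.
Qed.

End any_exponent.

(** * Finite exponents *)

Section finite_exponent.
Context {r : R} (r1 : (1 <= r%:E)%E).
Local Notation Lf := (LfunType mu r1).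
Local Notation Lp := (LspaceType mu r1).

Let r_gt0 : 0 < r. Proof. exact: lt_le_trans ltr01 r1. Qed.

Lemma Lclass_normX (f : Lf) :
  ((`|Lclass f : Lp| `^ r)%:E = \int[mu]_x (`|f x| `^ r)%:E)%E.
Proof.
rewrite -[`|Lclass f|]/(Lnrm (Lclass f)) Lclass_norm -poweR_EFin.
by rewrite finite_norm_fine powR_Lnorm ?gt_eqF.
Qed.

Lemma measurable_normX (f : Lf) :
  measurable_fun setT (fun x => (`|f x| `^ r)%:E).
Proof.
apply/measurable_EFinP; apply: (@measurableT_comp _ _ _ _ _ _ (@powR R ^~ r)) => //.
by apply: measurableT_comp => //; exact: measurable_Lfun.
Qed.

Lemma Lspace_clarkson k : 0 <= k ->
  (forall a b : R,
     `|a + b| `^ r + `|a - b| `^ r <= k * (`|a| `^ r + `|b| `^ r)) ->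
  forall F G : Lp,
    `|F + G| `^ r + `|F - G| `^ r <= k * (`|F| `^ r + `|G| `^ r).
Proof.
move=> k0 scal F G; rewrite -[F]LreprK -[G]LreprK.
move: (Lrepr F) (Lrepr G) => f g {F G}.
rewrite LclassNE !LclassDE -lee_fin EFinM !EFinD !Lclass_normX.
have mX := measurable_normX.
rewrite -!ge0_integralD//; do ?exact: mX.
rewrite -ge0_integralZl_EFin//; first last.
- by apply: emeasurable_funD; exact: mX.
- by move=> x _; rewrite -EFinD lee_fin addr_ge0 ?powR_ge0.
apply: ge0_le_integral => //.
- by move=> x _; rewrite -EFinD lee_fin addr_ge0 ?powR_ge0.
- by apply: emeasurable_funD; exact: mX.
- by apply: measurable_funeM; apply: emeasurable_funD; exact: mX.
- by move=> x _; rewrite -!EFinD -EFinM lee_fin; exact: scal.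
Qed.

(** Convexity bounds [(`|F + G| + `|F - G|) `^ r] by [2 `^ (r - 1)] times the
    sum of the r-th powers, hence by [2 `^ r * k * M `^ r]. *)
Lemma Lspace_parallelogram k : 0 <= k ->
  (forall a b : R,
     `|a + b| `^ r + `|a - b| `^ r <= k * (`|a| `^ r + `|b| `^ r)) ->
  forall M (F G : Lp), `|F| <= M -> `|G| <= M ->
    `|F + G| + `|F - G| <= 2 * (k `^ r^-1 * M).
Proof.
move=> k0 scal M F G FM GM.
have M0 : 0 <= M by apply: le_trans FM.
have rN0 : r != 0 by rewrite gt_eqF.
rewrite -[leLHS](powRK rN0) ?addr_ge0// -[leRHS](powRK rN0) ?mulr_ge0 ?powR_ge0//.
rewrite ge0_ler_powR ?nnegrE ?powR_ge0 ?invr_ge0 ?(ltW r_gt0)//.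
apply: le_trans (powR_midconvex r1 _ _) _ => //.
rewrite !powRM ?mulr_ge0 ?powR_ge0// powRVK//.
rewrite powRB ?pnatr_eq0 ?implybT// powRr1// -mulrA ler_wpM2l ?powR_ge0//.
rewrite ler_pdivrMl// mulrCA.
apply: le_trans (Lspace_clarkson k0 scal F G) _; rewrite ler_wpM2l//.
by rewrite mulr_natl mulr2n lerD// ge0_ler_powR ?nnegrE// ltW.
Qed.

Lemma norm_Lclass_disjointD (f g : Lf) : (forall x, f x = 0 \/ g x = 0) ->
  `|Lclass f : Lp| = 1 -> `|Lclass g : Lp| = 1 ->
  `|Lclass f + Lclass g : Lp| = 2 `^ r^-1.
Proof.
move=> fg f1 g1; have rN0 : r != 0 by rewrite gt_eqF.
rewrite LclassDE -[LHS](powRK rN0)//; congr (_ `^ _); apply: EFin_inj.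
rewrite Lclass_normX.
transitivity ((`|Lclass f : Lp| `^ r)%:E + (`|Lclass g : Lp| `^ r)%:E)%E; last first.
  by rewrite f1 g1 powR1.
rewrite !Lclass_normX -ge0_integralD//; try exact: measurable_normX.
apply: eq_integral => x _; rewrite -EFinD -[(f + g) x]/(f x + g x).
by case: (fg x) => ->; rewrite normr0 powR0// ?add0r ?addr0.
Qed.

Lemma cross_pair : dim_ge Lp 2 -> exists u v : Lp,
  [/\ `|u| = 1, `|v| = 1, `|u + v| = 2 `^ r^-1 & `|u - v| = 2 `^ r^-1].
Proof.
move=> /disjoint_unit_pair[f [g [fg f1 g1]]].
exists (Lclass f), (Lclass g); split=> //; first exact: norm_Lclass_disjointD.
rewrite LclassNE norm_Lclass_disjointD// -?LclassNE ?normrN// => x.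
by rewrite -[(- g) x]/(- g x); case: (fg x) => ->; [left|right; rewrite oppr0].
Qed.

End finite_exponent.

(** * Infinite exponent *)

Section infinite_exponent.
Context (p1 : (1 <= +oo :> \bar R)%E).
Local Notation Lf := (LfunType mu p1).
Local Notation Lp := (LspaceType mu p1).

Lemma le_Lclass_disjointD_infty (f g : Lf) : (forall x, f x = 0 \/ g x = 0) ->
  `|Lclass f : Lp| = 1 -> `|Lclass g : Lp| = 1 ->
  `|Lclass f + Lclass g : Lp| <= 1.
Proof.
move=> fg f1 g1.
(* When [mu] is zero the norm is 0 by convention and every property holds
   almost everywhere, so the equivalence holds in that case too. *)
have ae_le1 (h : Lf) : `|Lclass h : Lp| <= 1 <-> \forall x \ae mu, `|h x| <= 1.
  rewrite -[`|Lclass h|]/(Lnrm (Lclass h)) Lclass_norm -lee_fin finite_norm_fine.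
  rewrite unlock /Lnorm.
  case: ifPn => [mu0|mu0].
    split=> [/ess_supP|hx]; first by apply: filterS => x; rewrite lee_fin.
    by apply/ess_supP; apply: filterS hx => x; rewrite /= lee_fin.
  split=> // _.
  have {}mu0 : mu setT = 0 by apply/eqP; rewrite eq_le measure_ge0 leNgt mu0.
  by exists setT; split.
have [/ae_le1 fx /ae_le1 gx] : `|Lclass f : Lp| <= 1 /\ `|Lclass g : Lp| <= 1.
  by rewrite f1 g1.
rewrite LclassDE; apply/ae_le1; apply: filterS2 fx gx => x fx gx.
by rewrite -[(f + g) x]/(f x + g x); case: (fg x) => ->; rewrite ?add0r ?addr0.
Qed.

Lemma cross_pair_infty : dim_ge Lp 2 -> exists u v : Lp,
  [/\ `|u| = 1, `|v| = 1, `|u + v| <= 1 & `|u - v| <= 1].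
Proof.
move=> /disjoint_unit_pair[f [g [fg f1 g1]]].
exists (Lclass f), (Lclass g); split=> //; first exact: le_Lclass_disjointD_infty.
rewrite LclassNE le_Lclass_disjointD_infty// -?LclassNE ?normrN// => x.
by rewrite -[(- g) x]/(- g x); case: (fg x) => ->; [left|right; rewrite oppr0].
Qed.

End infinite_exponent.

End Lspace.

(** * The quadrilateral constant of a Lebesgue space *)

Theorem corollary5p12 (d : measure_display) (T : measurableType d)
    (R : realType) (mu : {measure set T -> \bar R})
    (p : \bar R) (p1 : (1 <= p)%E)
    (sepT : countably_generated T)
    (dim2 : dim_ge (LspaceType mu p1) 2) :
  ((p <= 2%:E)%E ->
     quad_const (LspaceType mu p1) = 2 `^ (fine p^-1%E)) /\
  ((2%:E <= p)%E ->
     quad_const (LspaceType mu p1) = 2 `^ (1 - fine p^-1%E)).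
Proof.
case: p p1 dim2 => [r| |//] r1 dim2; last first.
  split=> [|_]; first by rewrite leye_eq.
  rewrite invey subr0 powRr1//; apply: quad_const_eq => //.
    apply: four_point_of_parallelogram => M u v uM vM.
    apply: le_trans (lerD (ler_normD u v) (ler_normB u v)) _.
    by rewrite -mulr2n -[leLHS]mulr_natl ler_pM2l// mulr_natl mulr2n lerD.
  have [u [v [u1 v1 uvp uvm]]] := cross_pair_infty dim2.
  by move=> M M0 /(four_point_ge_of_diamond u1 v1 uvp uvm M0); rewrite mulr1.
have r0 : r != 0 by rewrite gt_eqF// (lt_le_trans ltr01).
have [u [v [u1 v1 uvp uvm]]] := cross_pair dim2.
rewrite fine_invr; split=> r2; apply: quad_const_eq; rewrite ?powR_ge0//.
- apply: four_point_of_parallelogram; apply: Lspace_parallelogram => // a b.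
  by apply: clarkson_le2; apply/andP; split=> //; exact: lt_le_trans ltr01 r1.
- by move=> M _; exact: four_point_ge_of_square uvm.
- have -> : 2 `^ (1 - r^-1) = (2 `^ (r - 1)) `^ r^-1 :> R.
    by rewrite -powRrM mulrBl mulfV// mul1r.
  apply: four_point_of_parallelogram; apply: Lspace_parallelogram => [|a b].
    exact: powR_ge0.
  exact: clarkson_ge2.
- move=> M M0 fp; rewrite powRB ?pnatr_eq0 ?implybT// powRr1//.
  rewrite ler_pdivrMr ?powR_gt0//.
  by apply: (four_point_ge_of_diamond u1 v1 _ _ M0 fp); rewrite ?uvp ?uvm.
Qed.
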